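(* Let $G$ be a finite simple group and $t\ge 2$ an integer. Let $A,B\subseteq G^t$ be subsets of positive densities $\alpha$ and $\beta$ respectively. If $a$ and $b$ are selected (independently and) uniformly from $A$ and $B$, then, for each $g\in G$, the probability that $a\bullet b=g$ is of the form $(1+o(1))|G|^{-1}$. In particular, if $G$ is sufficiently large (given $\alpha$ and $\beta$), then $A\bullet B=G$.
   Context: Finite simple groups are taken to be nonabelian. The density of $A\subseteq G^t$ is $|A|/|G|^t$. For $a=(a_1,\dots,a_t)$, $b=(b_1,\dots,b_t)\in G^t$ the interleaved product is $a\bullet b=a_1b_1a_2b_2\cdots a_tb_t\in G$, and $A\bullet B=\{a\bullet b : a\in A,\ b\in B\}$. Here $o(1)$ denotes a quantity tending to $0$ as $|G|\to\infty$, with $\alpha,\beta>0$ fixed: for fixed $\alpha,\beta$ and every $\delta>0$ there is $N$ such that for all finite simple $G$ with $|G|\ge N$, all $t\ge 2$, all $A,B\subseteq G^t$ of densities $\alpha,\beta$ and all $g\in G$, the quantity has absolute value at most $\delta$. *)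

(* Defs.v *)
From HB Require Import structures.
From mathcomp Require Import all_boot all_order all_algebra all_fingroup all_solvable.
From mathcomp Require Import reals.

Set Implicit Arguments.
Unset Strict Implicit.
Unset Printing Implicit Defensive.

Import GRing.Theory Num.Theory.
Local Open Scope ring_scope.

(* MathComp's [simple] allows the cyclic groups of prime order. *)
Definition nonabelian_simple (gT : finGroupType) : bool :=
  simple [set: gT] && ~~ abelian [set: gT].

Definition density (R : realType) (gT : finGroupType) (t : nat)
    (A : {set {ffun 'I_t -> gT}}) : R :=
  #|A|%:R / #|gT|%:R ^+ t.

Definition interleave (gT : finGroupType) (t : nat)
    (a b : {ffun 'I_t -> gT}) : gT :=
  (\prod_(i < t) (a i * b i))%g.

Definition interleave_set (gT : finGroupType) (t : nat)
    (A B : {set {ffun 'I_t -> gT}}) : {set gT} :=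
  [set interleave a b | a in A, b in B].

Definition uniform_prob (R : realType) (T : finType) (S : {set T})
    (P : pred T) : R :=
  #|[set x in S | P x]|%:R / #|S|%:R.

(* A pair drawn uniformly from [setX A B] has independent components, uniform
   on A and on B. *)
Definition prob_interleave (R : realType) (gT : finGroupType) (t : nat)
    (A B : {set {ffun 'I_t -> gT}}) (g : gT) : R :=
  uniform_prob R (setX A B) (fun ab => interleave ab.1 ab.2 == g).

(* Main.v *)
Require Import Defs.
From HB Require Import structures.
From mathcomp Require Import all_boot all_order all_algebra all_fingroup all_solvable.
From mathcomp Require Import all_field all_character.
From mathcomp Require Import reals zify ring lra.

(* A nonabelian simple group with a nontrivial irreducible character of degree
   at most d embeds in the unitary group U(d).  If the group is large, then by
   pigeonhole some nontrivial element is close to the identity; commutators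
   contract near the identity, so the nontrivial element closest to it commutes
   with all its conjugates, which then generate a nontrivial abelian normal
   subgroup, a contradiction.  Hence the least degree D of a nontrivial irreducible
   character tends to infinity with |G|.

   For t = 2, consider M(a,b) = n [a1 b1 a2 b2 = g] - 1 with n = |G|.  The
   second orthogonality relation gives, for u = a1^-1 a1' and v = a2 a2'^-1,
     sum_b M(a,b) M(a',b) = n^2 sum_(chi <> 1) chi(u) conj(chi(v)).
   The forms X_(chi,psi)(f) = sum_(a,a') f(a) f(a') chi(u) psi(v) are
   nonnegative, and sum_(chi,psi) chi(1) psi(1) X_(chi,psi)(f) = n^2 |f|^2 by
   the regular character, so the part of X carried by the pairs (chi, conj chi)
   with chi <> 1 is at most n^2 |f|^2 / D^2.  By Cauchy-Schwarz, M has operator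
   norm at most n^2 / D.  For larger t, fix the coordinates after the second
   and apply Cauchy-Schwarz over them: the relative error is at most
   1 / (D sqrt(alpha beta)), uniformly in t. *)

Set Implicit Arguments.
Unset Strict Implicit.
Unset Printing Implicit Defensive.

Import Order.TTheory GRing.Theory Num.Theory.
Local Open Scope ring_scope.

(** * Cauchy-Schwarz and the squared Frobenius norm *)

Lemma cauchy_schwarz_sum (R : numDomainType) (I : finType) (x y : I -> R) :
    (forall i, x i \is Num.real) -> (forall i, y i \is Num.real) ->
  (\sum_i x i * y i) ^+ 2 <= (\sum_i x i ^+ 2) * (\sum_i y i ^+ 2).
Proof.
move=> xr yr; rewrite -subr_ge0 -(pmulrn_lge0 _ (isT : (0 < 2)%N)).
(* Lagrange's identity: twice the deficit in Cauchy-Schwarz is a sum of real squares. *)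
suff -> : ((\sum_i x i ^+ 2) * (\sum_i y i ^+ 2) - (\sum_i x i * y i) ^+ 2) *+ 2
    = \sum_i \sum_j (x i * y j - x j * y i) ^+ 2.
  by apply: sumr_ge0 => i _; apply: sumr_ge0 => j _;
    rewrite real_exprn_even_ge0 // rpredB ?rpredM.
transitivity (\sum_i \sum_j (x i ^+ 2 * y j ^+ 2 + x j ^+ 2 * y i ^+ 2
    - (x i * y i) * (x j * y j) *+ 2)); last first.
  by apply: eq_bigr => i _; apply: eq_bigr => j _; ring.
under [RHS]eq_bigr => i _ do rewrite sumrB big_split /= -mulr_sumr -mulr_suml
  sumrMnl -mulr_sumr.
rewrite [RHS]sumrB big_split /= -mulr_suml -mulr_sumr sumrMnl -mulr_suml.
ring.
Qed.

Section FrobeniusNorm.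
Local Open Scope sesquilinear_scope.
Variables (C : numClosedFieldType) (n : nat).
Implicit Types A B U : 'M[C]_n.

Definition frobenius2 A : C := \sum_i \sum_j `|A i j| ^+ 2.

Lemma frobenius2_ge0 A : 0 <= frobenius2 A.
Proof. by apply: sumr_ge0 => i _; apply: sumr_ge0 => j _; rewrite exprn_ge0. Qed.

Lemma frobenius2_eq0 A : (frobenius2 A == 0) = (A == 0).
Proof.
apply/eqP/eqP => [A0|->]; last first.
  by apply: big1 => i _; apply: big1 => j _; rewrite mxE normr0 expr0n.
apply/matrixP => i j; rewrite mxE; apply/eqP; rewrite -normr_eq0 -sqrf_eq0.
have rowge0 k : true -> 0 <= \sum_l `|A k l| ^+ 2.
  by move=> _; apply: sumr_ge0 => l _; rewrite exprn_ge0.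
have /(_ i isT) Ai0 := psumr_eq0P rowge0 A0.
by apply/eqP; apply: (psumr_eq0P _ Ai0) => // l _; rewrite exprn_ge0.
Qed.

(** In trace form, invariance under unitary factors is immediate. *)
Lemma frobenius2_tr A : frobenius2 A = \tr (A *m A^t*).
Proof.
apply: eq_bigr => i _; rewrite mxE; apply: eq_bigr => j _.
by rewrite !mxE normCK.
Qed.

Lemma frobenius2_unitaryr A U : U \is unitarymx -> frobenius2 (A *m U) = frobenius2 A.
Proof.
move=> /unitarymxP UU; rewrite !frobenius2_tr trmx_mul map_mxM mulmxA.
by rewrite -(mulmxA A) UU mulmx1.
Qed.

Lemma frobenius2_unitaryl A U : U \is unitarymx -> frobenius2 (U *m A) = frobenius2 A.
Proof.
move=> Uu; have UU : U^t* *m U = 1%:M.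
  by apply: mulmx1C; apply/unitarymxP.
rewrite !frobenius2_tr trmx_mul map_mxM mulmxA mxtrace_mulC !mulmxA UU.
by rewrite mul1mx.
Qed.

(** Cauchy-Schwarz bounds each entry of the product by a row of [A] and a column of [B]. *)
Lemma frobenius2M A B : frobenius2 (A *m B) <= frobenius2 A * frobenius2 B.
Proof.
rewrite /frobenius2 mulr_suml; apply: ler_sum => i _.
rewrite [X in _ * X]exchange_big mulr_sumr /=; apply: ler_sum => j _.
rewrite mxE; apply: le_trans (cauchy_schwarz_sum _ _); last 2 first.
- by move=> k; apply: normr_real.
- by move=> k; apply: normr_real.
rewrite lerXn2r ?nnegrE ?sumr_ge0 // => [k _|]; first by rewrite mulr_ge0.
by apply: le_trans (ler_norm_sum _ _ _) _; apply: ler_sum => k _; rewrite normrM.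
Qed.

Lemma frobenius2B A B : frobenius2 (A - B) <= (frobenius2 A + frobenius2 B) *+ 2.
Proof.
rewrite /frobenius2 -big_split -sumrMnl; apply: ler_sum => i _ /=.
rewrite -big_split -sumrMnl; apply: ler_sum => j _ /=.
rewrite !mxE; apply: le_trans (_ : (`|A i j| + `|B i j|) ^+ 2 <= _).
  by rewrite lerXn2r ?nnegrE ?addr_ge0 // ler_normB.
rewrite -subr_ge0; have -> : (`|A i j| ^+ 2 + `|B i j| ^+ 2) *+ 2 -
   (`|A i j| + `|B i j|) ^+ 2 = (`|A i j| - `|B i j|) ^+ 2 by ring.
by rewrite real_exprn_even_ge0 // rpredB ?normr_real.
Qed.

Lemma unitarymx_entry_le1 U i j : U \is unitarymx -> `|U i j| <= 1.
Proof.
move=> /unitarymxP/matrixP/(_ i i); rewrite [RHS]mxE eqxx mxE /= mulr1n => UU.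
rewrite -(@expr_le1 _ 2) // -UU (bigD1 j) //= !mxE -normCK lerDl.
by apply: sumr_ge0 => k _; rewrite !mxE -normCK exprn_ge0.
Qed.

End FrobeniusNorm.

(** * Unitarizing representations of finite groups *)

Section Unitarization.
Local Open Scope sesquilinear_scope.

(* Weyl's averaging trick: the rho-invariant positive form
   sum_g rho(g) rho(g)^* is diagonalised by a unitary matrix, and rescaling the
   diagonal turns it into the standard form. *)
Lemma mx_repr_unitarizable (C : numClosedFieldType) (gT : finGroupType)
    (n : nat) (rho : gT -> 'M[C]_n) :
    rho 1%g = 1%:M -> {morph rho : x y / (x * y)%g >-> x *m y} ->
  exists2 S : 'M[C]_n, S \in unitmx &
    forall x, S *m rho x *m invmx S \is unitarymx.
Proof.
move=> rho1 rhoM; pose H := \sum_g rho g *m (rho g)^t*.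
have tcM m p q (A : 'M[C]_(m, p)) (B : 'M_(p, q)) :
  (A *m B)^t* = B^t* *m A^t* by rewrite trmx_mul map_mxM.
have HE x : rho x *m H *m (rho x)^t* = H.
  rewrite /H mulmx_sumr mulmx_suml [RHS](reindex_inj (mulgI x)) /=.
  by apply: eq_bigr => g _; rewrite rhoM tcM !mulmxA.
have Hherm : H^t* = H.
  rewrite /H; have -> : (\sum_g rho g *m (rho g)^t*)^t* =
     \sum_g (rho g *m (rho g)^t*)^t*.
    by rewrite raddf_sum; apply: (raddf_sum (map_mx Num.conj)).
  by apply: eq_bigr => g _; rewrite tcM trmxCK.
pose P := spectralmx H; pose d := spectral_diag H.
have Pu : P \is unitarymx by apply: spectral_unitarymx.
have PP : P *m P^t* = 1%:M by apply/unitarymxP.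
have Punit : P \in unitmx by apply: spectral_unit.
have PHP : P *m H *m P^t* = diag_mx d.
  have /orthomx_spectralP eH : H \is normalmx by apply/normalmxP; rewrite Hherm.
  by rewrite {1}eH -/P -/d !mulmxA mulmxV // mul1mx -mulmxA PP mulmx1.
(* Each eigenvalue is a sum of squared row norms of P rho(g); the term g = 1 equals 1 since [P] is
   unitary. *)
have d_gt0 i : 0 < d 0 i.
  have -> : d 0 i = \sum_g \sum_j `|(P *m rho g) i j| ^+ 2.
    have <- : diag_mx d i i = d 0 i by rewrite mxE eqxx.
    rewrite -PHP /H mulmx_sumr mulmx_suml summxE; apply: eq_bigr => g _.
    rewrite !mulmxA -mulmxA -tcM mxE; apply: eq_bigr => j _.
    by rewrite [X in _ * X]mxE [X in _ * Num.conj X]mxE normCK.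
  rewrite (bigD1 1%g) //= ltr_wpDr //.
    by apply: sumr_ge0 => g _; apply: sumr_ge0 => j _; rewrite exprn_ge0.
  suff -> : \sum_j `|(P *m rho 1%g) i j| ^+ 2 = 1 by apply: ltr01.
  rewrite rho1 mulmx1; have := congr1 (fun M => fun_of_matrix M i i) PP.
  rewrite [RHS]mxE eqxx mxE /= mulr1n => <-; apply: eq_bigr => j _.
  by rewrite !mxE normCK.
pose E := diag_mx (\row_i (sqrtC (d 0 i))^-1).
pose S := E *m P.
have EE : E^t* = E.
  rewrite /E tr_diag_mx map_diag_mx; congr diag_mx; apply/rowP => i; rewrite !mxE.
  by apply: CrealP; rewrite rpredV realE sqrtC_ge0 ltW.
have SHS : S *m H *m S^t* = 1%:M.
  rewrite /S tcM EE !mulmxA -(mulmxA E) -(mulmxA E (_ *m _)) PHP.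
  rewrite /E !mulmx_diag; apply/matrixP => i j; rewrite !mxE.
  have [->|] := eqVneq i j; last by rewrite !mulr0n.
  rewrite !mulr1n mulrAC -invfM -expr2 sqrtCK mulVf //.
  by rewrite gt_eqF.
have Sunit : S \in unitmx by have := SHS; rewrite -mulmxA => /mulmx1_unit [].
clearbody S; exists S => // x; apply/unitarymxP.
(* Since [S] carries [H] to the identity form, invariance of [H] becomes unitarity of S rho(x)
   S^-1. *)
have key : invmx S *m (invmx S)^t* = H.
  rewrite -{1}[invmx S]mulmx1 -SHS !mulmxA mulVmx // mul1mx -mulmxA -tcM.
  by rewrite mulVmx // trmx1 map_mx1 mulmx1.
by rewrite !tcM -!mulmxA (mulmxA (invmx S)) key (mulmxA H) (mulmxA (rho x))
  (mulmxA (rho x)) HE mulmxA.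
Qed.

End Unitarization.

(** * Unitary representations of bounded degree *)

Definition grid_cell (K : nat) (z : algC) : 'I_(2 * K).+1 * 'I_(2 * K).+1 :=
  (inord (Num.truncn (K%:R * ('Re z + 1))), inord (Num.truncn (K%:R * ('Im z + 1)))).

Lemma truncn_eq_dist (x y : algC) :
  0 <= x -> 0 <= y -> Num.truncn x = Num.truncn y -> (x - y) ^+ 2 <= 1.
Proof.
move=> x0 y0 exy; have /andP[x1 x2] := truncn_itv x0.
have /andP[y1 y2] := truncn_itv y0; rewrite -exy -natr1 in y1 y2.
rewrite -natr1 in x2.
have xr : x - y \is Num.real by rewrite rpredB // ger0_real.
rewrite -real_normK // expr_le1 // real_ler_norml //; apply/andP; split.
  rewrite lerBrDr addrC lerBlDr; apply: le_trans (ltW y2) _.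
  by rewrite lerD2r.
rewrite lerBlDr addrC; apply: le_trans (ltW x2) _.
by rewrite lerD2r.
Qed.

(** The cells have side 1/K, so real and imaginary parts each contribute at most 1 after scaling by
    K^2. *)
Lemma grid_cell_dist (K : nat) (z w : algC) : `|z| <= 1 -> `|w| <= 1 ->
  grid_cell K z = grid_cell K w -> `|z - w| ^+ 2 * K%:R ^+ 2 <= 2.
Proof.
have part_real u : ('Re u \is Num.real) * ('Im u \is Num.real).
  by rewrite Creal_Re Creal_Im.
have part_bd u : `|u| <= 1 -> (`|'Re u| <= 1) * (`|'Im u| <= 1).
  rewrite -(@expr_le1 _ 2) // normC2_Re_Im => u1.
  split; rewrite -(@expr_le1 _ 2) // real_normK ?part_real //;
    apply: le_trans u1; rewrite ?lerDl ?lerDr real_exprn_even_ge0 ?part_real //.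
have coord (x y : algC) : x \is Num.real -> y \is Num.real ->
    `|x| <= 1 -> `|y| <= 1 ->
    inord (Num.truncn (K%:R * (x + 1))) = inord (Num.truncn (K%:R * (y + 1)))
      :> 'I_(2 * K).+1 -> (x - y) ^+ 2 * K%:R ^+ 2 <= 1.
  move=> xr yr x1 y1.
  have bd (u : algC) : u \is Num.real -> `|u| <= 1 -> 0 <= K%:R * (u + 1) <= (2 * K)%:R.
    move=> ur; rewrite real_ler_norml // => /andP[u1 u2].
    rewrite mulr_ge0 //=; last by rewrite -(opprK 1) subr_ge0.
    by rewrite mulnC natrM ler_wpM2l // lerD.
  (* The endpoint u = 1 attains the value 2K, hence 2K + 1 indices per axis. *)
  have tr (u : algC) : u \is Num.real -> `|u| <= 1 ->
      (Num.truncn (K%:R * (u + 1)%R) < (2 * K).+1)%N.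
    move=> ur /(bd u ur) /andP[u1 u2]; rewrite ltnS.
    by rewrite -(@natrK algC (2 * K)) le_truncn.
  move=> /(congr1 val) /=; rewrite !inordK ?tr // => /truncn_eq_dist.
  have /andP[-> _] := bd x xr x1; have /andP[-> _] := bd y yr y1.
  move=> /(_ isT isT); rewrite -mulrBr exprMn mulrC.
  by have -> : x + 1 - (y + 1) = x - y by ring.
move=> z1 w1 [eR eI]; rewrite normC2_Re_Im !raddfB mulrDl -[2]/(1 + 1).
by apply: lerD; apply: coord; rewrite ?part_real // ?part_bd.
Qed.

Lemma unitary_pigeonhole (d : nat) : exists N : nat,
  forall (I : finType) (n : nat) (u : I -> 'M[algC]_n),
    (n <= d)%N -> (N < #|I|)%N -> (forall x, u x \is unitarymx) ->
  exists x y, x != y /\ frobenius2 (u x - u y) *+ 4 < 1.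
Proof.
(* Entries in a common cell of side 1/K give a squared distance at most
   2 d^2 / K^2 < 1/4. *)
pose K := (4 * d).+1; pose c := ((2 * K).+1 * (2 * K).+1)%N.
exists (c ^ (d * d))%N => I n u nd Icard uu.
pose F x : {ffun 'I_n * 'I_n -> _} := [ffun p => grid_cell K (u x p.1 p.2)].
have [/injectiveP/leq_card|] := boolP (injectiveb F).
  rewrite card_ffun !card_prod !card_ord leqNgt => /negP[].
  by apply: leq_ltn_trans Icard; rewrite leq_pexp2l // leq_mul.
case/injectivePn => x [y xy Fxy]; exists x, y; split=> //.
have Kgt0 : 0 < K%:R ^+ 2 :> algC by rewrite exprn_gt0 ?ltr0n.
rewrite -(ltr_pM2r Kgt0) mul1r.
apply: (@le_lt_trans _ _ ((2 * (n * n)) * 4)%:R); last first.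
  rewrite -natrX ltr_nat.
  apply: (@leq_ltn_trans ((2 * (d * d)) * 4)); first by rewrite leq_mul2r !leq_mul.
  by rewrite /K; nia.
rewrite mulrnAl natrM -mulr_natr ler_wpM2r // /frobenius2.
rewrite mulr_suml natrM.
have -> : 2%:R * (n * n)%:R = \sum_(i < n) \sum_(j < n) 2%:R :> algC.
  by rewrite !sumr_const !card_ord -mulrnA mulr_natr.
apply: ler_sum => i _; rewrite mulr_suml; apply: ler_sum => j _.
rewrite !mxE; apply: grid_cell_dist; rewrite ?unitarymx_entry_le1 //.
by have /ffunP/(_ (i, j)) := Fxy; rewrite !ffunE.
Qed.

(* Commutators contract towards the identity, so a nontrivial element whose
   image is closest to the identity commutes with its conjugates, which are
   equally close. *)
Lemma faithful_unitary_card_bound (d : nat) : exists N : nat,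
  forall (gT : finGroupType) (n : nat) (u : gT -> 'M[algC]_n),
    (n <= d)%N -> nonabelian_simple gT -> (N < #|gT|)%N ->
    (forall x, u x \is unitarymx) ->
    {morph u : x y / (x * y)%g >-> x *m y} -> injective u -> False.
Proof.
have [N HN] := unitary_pigeonhole d; exists N.
move=> gT n u nd /andP[simpG nabG] Ncard uu uM uinj.
have u1 : u 1%g = 1%:M.
  have uun := unitarymx_unit (uu 1%g).
  by rewrite -[LHS](mulmxK uun) -uM mulg1 mulmxV.
pose f x := frobenius2 (u x - 1%:M).
have f_gt0 x : x != 1%g -> 0 < f x.
  move=> x1; rewrite lt_def frobenius2_ge0 andbT frobenius2_eq0 subr_eq0 -u1.
  by rewrite (inj_eq uinj).
have fJ x y : f (x ^ y)%g = f x.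
  rewrite /f -(frobenius2_unitaryl _ (uu y)) -[RHS](frobenius2_unitaryr _ (uu y)).
  by rewrite mulmxBr mulmxBl -!uM mulmx1 mul1mx -conjgC.
have fR x y : f [~ x, y]%g <= f x * f y *+ 4.
  rewrite /f -(frobenius2_unitaryl _ (uu (y * x)%g)) mulmxBr -uM mulmx1 -commgC !uM.
  (* The identity matrix is central, so subtracting it from both factors leaves the additive
     commutator unchanged. Each of its two products costs f(x) f(y), and [frobenius2B] doubles the
     sum. *)
  have -> : u x *m u y - u y *m u x =
     (u x - 1%:M) *m (u y - 1%:M) - (u y - 1%:M) *m (u x - 1%:M).
    rewrite !mulmxBl !mulmxBr !mul1mx !mulmx1 !opprB.
    rewrite [in RHS]addrACA; apply/matrixP => i j; rewrite !mxE; ring.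
  apply: le_trans (frobenius2B _ _) _.
  rewrite -[4%N]/(2 * 2)%N mulrnA lerMn2r /= mulr2n lerD ?frobenius2M //.
  by rewrite mulrC frobenius2M.
(* If the images of x and y are close, x y^-1 is close to the identity by unitary invariance. *)
have [x0 x0n1 fx0] : exists2 x, x != 1%g & f x *+ 4 < 1.
  have [x [y [xy xy4]]] := HN _ _ _ nd Ncard uu.
  exists (x * y^-1)%g; first by rewrite -eq_mulgV1.
  by rewrite /f -(frobenius2_unitaryr _ (uu y)) mulmxBl -uM mulgKV mul1mx.
have freal : {in [pred x | x != 1%g] &, forall x y, f x >=< f y}.
  by move=> x y _ _; apply: real_comparable; rewrite ger0_real ?frobenius2_ge0.
have [x xn1 xmin] : exists2 x, x != 1%g & forall y, y != 1%g -> f x <= f y.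
  have [x xn1 xmin] := @comparable_arg_minP _ _ _ x0 [pred x | x != 1%g] f x0n1 freal.
  by exists x => // y /xmin.
have fx : f x *+ 4 < 1 by apply: le_lt_trans fx0; rewrite lerMn2r xmin.
(* Otherwise minimality gives f(x) <= f([x, x^y]) <= 4 f(x)^2 < f(x). *)
have xJ y : commute x (x ^ y)%g.
  apply/commgP; apply: contraT => /xmin/le_trans/(_ (fR _ _)).
  have : f x * f (x ^ y)%g *+ 4 < f x by rewrite fJ -mulrnAr gtr_pMr // f_gt0.
  by move=> /lt_le_trans h /h; rewrite ltxx.
have abx : abelian (x ^: [set: gT])%g.
  apply/centsP => _ /imsetP[a _ ->] _ /imsetP[b _ ->].
  (* Conjugation by a takes the commuting pair x, x^(b a^-1) to x^a, x^b. *)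
  have : ((x * x ^ (b * a^-1)) ^ a = (x ^ (b * a^-1) * x) ^ a)%g by rewrite xJ.
  by rewrite (conjMg x) (conjMg _ x) -!(conjgM x) mulgKV.
pose H := <<x ^: [set: gT]>>%G.
have nHG : (H <| [set: gT])%g.
  by rewrite /normal subsetT /= norms_gen // class_norm.
case/simpleP: simpG => _ /(_ H nHG) [] eH.
  have : x \in H by rewrite mem_gen // class_refl.
  by rewrite eH => /set1P xe; rewrite xe eqxx in xn1.
case/negP: nabG; by rewrite -[X in abelian X]/(gval [set: gT]%G) -eH /= abelian_gen.
Qed.

Lemma nonabelian_simple_irr_degree (d : nat) : exists N : nat,
  forall gT : finGroupType, nonabelian_simple gT -> (N < #|gT|)%N ->
  forall i : Iirr [set: gT], i != 0 -> d.+1%:R <= 'chi_i 1%g.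
Proof.
have [N HN] := faithful_unitary_card_bound d; exists N => gT simpG Ncard i i0.
rewrite irr1_degree ler_nat ltnNge; apply/negP => nd.
pose rG := 'Chi_i.
(* The kernel is normal, hence trivial or everything; the latter happens only for the trivial
   character. *)
have ker1 : cfker 'chi_i = [1 gT]%g.
  have /andP[/simpleP[_ /(_ (cfker 'chi_i)%G (cfker_normal _))[]//= kG] _] := simpG.
  by move: i0; rewrite -subGcfker kG subxx.
have rGinj : injective rG.
  have ff : mx_faithful rG.
    by rewrite /mx_faithful -cfker_repr irrRepr ker1.
  by move=> x y; apply: (mx_faithful_inj ff); rewrite inE.
have rGM : {morph rG : x y / (x * y)%g >-> x *m y}.
  by move=> x y; rewrite repr_mxM ?inE.
clearbody rG; have [S Su Suni] := mx_repr_unitarizable (repr_mx1 rG) rGM.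
apply: (HN gT _ (fun x => S *m rG x *m invmx S) nd simpG Ncard Suni).
  by move=> x y; rewrite /= rGM !mulmxA mulmxKV.
move=> x y /(congr1 (fun M => invmx S *m M *m S)) /= eqxy; apply: rGinj.
by rewrite !mulmxA mulVmx // !mul1mx !mulmxKV in eqxy.
Qed.

(** * Characters and mixing for two coordinates *)

Section MixingTwo.
Variable gT : finGroupType.
Notation G := [set: gT].
Notation n := (#|gT|%:R : algC).
Implicit Types (f h : gT * gT -> algC) (i j : Iirr G) (a b : gT * gT).

(** An irreducible character is, up to a positive factor, its own convolution square. This exhibits
    chi(x^-1 y) as a Gram kernel, the source of positivity below. *)
Lemma irr_convolution i (x y : gT) :
  'chi_i (x^-1 * y)%g = 'chi_i 1%g / n * \sum_w 'chi_i (w * y)%g * ('chi_i (w * x)%g)^*.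
Proof.
have e := generalized_orthogonality_relation (x^-1 * y)%g i i.
rewrite eqxx mul1r cardsT in e.
rewrite -[LHS](divfK (irr1_neq0 i)) -e mulrC mulrA; congr (_ * _).
rewrite (reindex_inj (mulIg x)) /=; apply: eq_big => [w|w _]; first by rewrite inE.
by rewrite -irr_inv mulgA mulgK.
Qed.

Lemma cfunC (phi : 'CF(G)) (x y : gT) : phi (x * y)%g = phi (y * x)%g.
Proof. by rewrite -[in RHS](cfunJ phi _ (in_setT y)) conjgE !mulgA mulVg mul1g. Qed.

Definition irr_form f i j : algC := \sum_a \sum_a' f a * f a' *
  ('chi_i (a.1^-1 * a'.1)%g * 'chi_j (a.2 * a'.2^-1)%g).

Lemma irr_form_ge0 f i j : (forall a, f a \is Num.real) -> 0 <= irr_form f i j.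
Proof.
(* In u the inverse falls on a, in v on a'; hence only the second character is conjugated in [s]. *)
move=> fr; pose s w v := \sum_a f a * ('chi_i (w * a.1)%g * ('chi_j (v * a.2)%g)^*).
suff -> : irr_form f i j = ('chi_i 1%g / n) * ('chi_j 1%g / n) *
    \sum_w \sum_v `|s w v| ^+ 2.
  apply: mulr_ge0; first by rewrite !mulr_ge0 ?invr_ge0 ?ler0n ?ltW ?irr1_gt0.
  by apply: sumr_ge0 => w _; apply: sumr_ge0 => v _; rewrite exprn_ge0.
rewrite /irr_form.
transitivity (\sum_a \sum_a' \sum_w \sum_v ('chi_i 1%g / n) * ('chi_j 1%g / n) *
  ((f a' * ('chi_i (w * a'.1)%g * ('chi_j (v * a'.2)%g)^*)) *
   (f a * ('chi_i (w * a.1)%g * ('chi_j (v * a.2)%g)^* ))^* )).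
  apply: eq_bigr => a _; apply: eq_bigr => a' _.
  rewrite (cfunC 'chi_j) !irr_convolution [X in _ * X]mulrACA [in LHS]big_distrlr /=.
  rewrite mulrCA !mulr_sumr; apply: eq_bigr => w _.
  rewrite !mulr_sumr; apply: eq_bigr => v _; congr (_ * _).
  by rewrite !rmorphM /= (CrealP (fr a)) conjCK; ring.
under eq_bigr => a _ do rewrite exchange_big.
rewrite exchange_big /= mulr_sumr; apply: eq_bigr => w _.
under eq_bigr => a _ do rewrite exchange_big.
rewrite exchange_big /= mulr_sumr; apply: eq_bigr => v _.
rewrite normCK /s rmorph_sum /= big_distrlr /= exchange_big mulr_sumr /=.
by apply: eq_bigr => a _; rewrite mulr_sumr; apply: eq_bigr.
Qed.

Lemma irr_regular (x : gT) : \sum_(i : Iirr G) 'chi_i 1%g * 'chi_i x = n *+ (x == 1%g).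
Proof.
have := congr1 (fun phi : 'CF(G) => phi x) (cfReg_sum G).
rewrite cfRegE cardsT sum_cfunE => ->.
by apply: eq_bigr => i _; rewrite cfunE.
Qed.

(** The regular character vanishes off the identity, so only the diagonal a = a' survives. *)
Lemma irr_form_sum f :
  \sum_i \sum_j 'chi_i 1%g * 'chi_j 1%g * irr_form f i j = n ^+ 2 * \sum_a f a ^+ 2.
Proof.
transitivity (\sum_a \sum_a' f a * f a' *
  ((\sum_(i : Iirr G) 'chi_i 1%g * 'chi_i (a.1^-1 * a'.1)%g) *
   (\sum_(j : Iirr G) 'chi_j 1%g * 'chi_j (a.2 * a'.2^-1)%g))).
  under eq_bigr => i _ do (under eq_bigr => j _ do rewrite mulr_sumr;
    rewrite exchange_big /=).
  rewrite exchange_big; apply: eq_bigr => a _ /=.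
  under eq_bigr => i _ do (under eq_bigr => j _ do rewrite mulr_sumr;
    rewrite exchange_big /=).
  rewrite exchange_big; apply: eq_bigr => a' _ /=.
  rewrite big_distrlr mulr_sumr; apply: eq_bigr => i _ /=.
  by rewrite mulr_sumr; apply: eq_bigr => j _; ring.
rewrite mulr_sumr; apply: eq_bigr => a _.
rewrite (bigD1 a) //= [X in _ + X]big1 ?addr0 => [|a' ne].
  by rewrite !irr_regular mulVg mulgV !eqxx !mulr1n; ring.
rewrite !irr_regular -eq_mulVg1 -eq_mulgV1.
have [e1|] := eqVneq a.1 a'.1; have [e2|] := eqVneq a.2 a'.2;
  rewrite ?mulr0n ?mul0r ?mulr0 //.
by case/eqP: ne; case: (a) (a') e1 e2 => [? ?] [? ?] /= -> ->.
Qed.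

(** All terms of [irr_form_sum] are nonnegative, and the pairs kept have weight chi(1)^2 >= D^2. *)
Lemma irr_form_bound (D : nat) f : (forall a, f a \is Num.real) ->
    (forall i, i != 0 -> D%:R <= 'chi_i 1%g) ->
  D%:R ^+ 2 * \sum_(i | i != 0) irr_form f i (conjC_Iirr i)
    <= n ^+ 2 * \sum_a f a ^+ 2.
Proof.
move=> fr HD; rewrite -irr_form_sum mulr_sumr [leRHS](bigID (fun i => i != 0)) /=.
have pos i j : 0 <= 'chi_i 1%g * 'chi_j 1%g * irr_form f i j.
  by rewrite !mulr_ge0 ?irr_form_ge0 ?ltW ?irr1_gt0.
apply: ler_wpDr.
  by apply: sumr_ge0 => i _; apply: sumr_ge0.
apply: ler_sum => i i0; rewrite (bigD1 (conjC_Iirr i)) //=.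
apply: ler_wpDr; first by apply: sumr_ge0.
apply: ler_wpM2r; first exact: irr_form_ge0.
by rewrite expr2 ler_pM ?ler0n // HD // conjC_Iirr_eq0.
Qed.

(** Both sides are the order of the centraliser of u if u and v are conjugate, and 0 otherwise. *)
Lemma irr_conjg_count (u v : gT) :
  \sum_(i : Iirr G) 'chi_i u * ('chi_i v)^* = \sum_b ((u ^ b)%g == v)%:R.
Proof.
rewrite second_orthogonality_relation ?inE //.
have [|nuv] := boolP (u \in (v ^: G)%g); last first.
  rewrite mulr0n big1 // => b _; case: eqP => // e; case/negP: nuv.
  by apply/imsetP; exists b^-1%g; rewrite ?inE // -e conjgK.
rewrite class_sym => /imsetP[c _ ->]; rewrite mulr1n [RHS](reindex_inj (mulIg c)) /=.
rewrite -natr_sum -sum1_card [in LHS]big_mkcond /=; congr _%:R.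
apply: eq_bigr => b _; rewrite conjgM (inj_eq (conjg_inj c)) in_setI in_setT /=.
by rewrite cent1E -[(u ^ b == u)%g](inj_eq (mulgI b)) -conjgC eq_sym; case: eqP.
Qed.

Definition interleave2_dev (g : gT) a b : algC :=
  n * (a.1 * b.1 * a.2 * b.2 == g)%g%:R - 1.

Lemma sum_indicator_dev (I : finType) (c c' : I) :
  \sum_y (#|I|%:R * (y == c)%:R - 1) * (#|I|%:R * (y == c')%:R - 1) =
  #|I|%:R ^+ 2 * (c == c')%:R - #|I|%:R :> algC.
Proof.
have sum1 (d : I) : \sum_y (y == d)%:R = 1 :> algC.
  by rewrite (bigD1 d) //= eqxx big1 ?addr0 // => y /negbTE ->.
have sum2 : \sum_y (y == c)%:R * (y == c')%:R = (c == c')%:R :> algC.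
  rewrite (bigD1 c) //= eqxx mul1r big1 ?addr0 // => y /negbTE ->.
  by rewrite mul0r.
transitivity (\sum_y (#|I|%:R ^+ 2 * ((y == c)%:R * (y == c')%:R)
   - #|I|%:R * (y == c)%:R - #|I|%:R * (y == c')%:R + 1 : algC)).
  by apply: eq_bigr => y _; ring.
rewrite !big_split /= !sumrN -!mulr_sumr sum2 !sum1 sumr_const; ring.
Qed.

(** Given b1 = x, each of a and a' determines b2; the two values agree exactly when a1 x a2 = a1' x
    a2', that is, u^x = v. Counting such x by characters, the trivial one contributes the 1 that
    centring removes. *)
Lemma interleave2_dev_corr (g : gT) a a' :
  \sum_b interleave2_dev g a b * interleave2_dev g a' b =
  n ^+ 2 * \sum_(i : Iirr G | i != 0)
    'chi_i (a.1^-1 * a'.1)%g * 'chi_(conjC_Iirr i) (a.2 * a'.2^-1)%g.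
Proof.
have -> : \sum_(i : Iirr G | i != 0)
    'chi_i (a.1^-1 * a'.1)%g * 'chi_(conjC_Iirr i) (a.2 * a'.2^-1)%g =
  \sum_x (a.1 * x * a.2 == a'.1 * x * a'.2)%g%:R - 1.
  rewrite (eq_bigr (fun x => ((a.1^-1 * a'.1) ^ x == a.2 * a'.2^-1)%g%:R))
    => [|x _]; last first.
    congr (nat_of_bool _)%:R; rewrite conjgE -[RHS](inj_eq (mulgI (a.1 * x)%g)).
    by rewrite -[RHS](inj_eq (mulIg a'.2)) eq_sym !mulgA mulgKV mulgK mulgV mul1g.
  rewrite -irr_conjg_count [in RHS](bigD1 0) //= irr0 !cfun1E !inE mulr1n conjC1 mulr1.
  by rewrite [RHS]addrC addKr; apply: eq_bigr => i _; rewrite conjC_IirrE cfunE.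
rewrite -(pair_bigA _ (fun x y =>
  interleave2_dev g a (x, y) * interleave2_dev g a' (x, y))) /=.
transitivity (\sum_(x : gT) (n ^+ 2 * (a.1 * x * a.2 == a'.1 * x * a'.2)%g%:R - n)).
  apply: eq_bigr => x _; rewrite /interleave2_dev /=.
  have e c (y : gT) : (c * y == g)%g = (y == c^-1 * g)%g.
    by rewrite -(inj_eq (mulgI c) y) mulKVg.
  under eq_bigr => y _ do rewrite !e.
  rewrite sum_indicator_dev (inj_eq (mulIg g)) (inj_eq invg_inj) //.
rewrite sumrB sumr_const -mulr_sumr -mulr_natr; ring.
Qed.

(** Cauchy-Schwarz over b leaves the squared norm of f M. One n^2 comes from the correlations of M,
    the other from the regular character. *)
Lemma interleave2_bound (D : nat) (g : gT) f h :
    (forall a, f a \is Num.real) -> (forall b, h b \is Num.real) ->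
    (forall i, i != 0 -> D%:R <= 'chi_i 1%g) ->
  D%:R ^+ 2 * (\sum_a \sum_b f a * h b * interleave2_dev g a b) ^+ 2
    <= n ^+ 4 * ((\sum_a f a ^+ 2) * (\sum_b h b ^+ 2)).
Proof.
move=> fr hr HD; pose F b := \sum_a f a * interleave2_dev g a b.
have devr a b : interleave2_dev g a b \is Num.real.
  by rewrite rpredB ?rpredM ?rpred1 ?realn.
have Fr b : F b \is Num.real by apply: rpred_sum => a _; rewrite rpredM.
have -> : \sum_a \sum_b f a * h b * interleave2_dev g a b = \sum_b h b * F b.
  rewrite exchange_big; apply: eq_bigr => b _; rewrite mulr_sumr.
  by apply: eq_bigr => a _ /=; ring.
have FF : \sum_b F b ^+ 2 =
    n ^+ 2 * \sum_(i | i != 0) irr_form f i (conjC_Iirr i).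
  transitivity (\sum_a \sum_a' f a * f a' *
      \sum_b interleave2_dev g a b * interleave2_dev g a' b).
    under eq_bigr => b _ do rewrite expr2 big_distrlr /=.
    rewrite exchange_big; apply: eq_bigr => a _ /=.
    rewrite exchange_big; apply: eq_bigr => a' _ /=.
    by rewrite mulr_sumr; apply: eq_bigr => b _; ring.
  rewrite mulr_sumr /irr_form.
  under [RHS]eq_bigr => i _ do rewrite mulr_sumr.
  rewrite [RHS]exchange_big; apply: eq_bigr => a _ /=.
  under [RHS]eq_bigr => i _ do rewrite mulr_sumr.
  rewrite [RHS]exchange_big; apply: eq_bigr => a' _ /=.
  rewrite interleave2_dev_corr mulrCA !mulr_sumr; apply: eq_bigr => i _; ring.
apply: le_trans (_ : D%:R ^+ 2 * ((\sum_b h b ^+ 2) * (\sum_b F b ^+ 2)) <= _).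
  by rewrite ler_wpM2l ?exprn_ge0 ?ler0n // cauchy_schwarz_sum.
have -> : n ^+ 4 * ((\sum_a f a ^+ 2) * \sum_b h b ^+ 2) =
  (n ^+ 2 * \sum_b h b ^+ 2) * (n ^+ 2 * \sum_a f a ^+ 2) by ring.
rewrite FF; have -> (S X : algC) : D%:R ^+ 2 * (S * (n ^+ 2 * X)) =
   n ^+ 2 * S * (D%:R ^+ 2 * X) by ring.
rewrite ler_wpM2l ?irr_form_bound // mulr_ge0 ?exprn_ge0 ?ler0n ?sumr_ge0 // => b _.
by rewrite real_exprn_even_ge0.
Qed.

End MixingTwo.

(** * Reduction of longer tuples to two coordinates *)

Section MixingMany.
Variables (gT : finGroupType) (s : nat).
Notation n := (#|gT|%:R : algC).
Implicit Types (p q : gT * gT) (c d : {ffun 'I_s -> gT}).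

Definition ffun_cons2 p c : {ffun 'I_s.+2 -> gT} :=
  [ffun i => oapp (fun j => oapp c p.2 (unlift ord0 j)) p.1 (unlift ord0 i)].

Lemma interleave_cons2 p c q d :
  interleave (ffun_cons2 p c) (ffun_cons2 q d) =
    (p.1 * q.1 * p.2 * q.2 * interleave c d)%g.
Proof.
rewrite /interleave !big_ord_recl !ffunE unlift_none liftK /= unlift_none /=.
rewrite !mulgA; congr (_ * _)%g; apply: eq_bigr => i _.
by rewrite !ffunE !liftK /= !liftK.
Qed.

Lemma sum_ffun_cons2 (F : {ffun 'I_s.+2 -> gT} -> algC) :
  \sum_a F a = \sum_c \sum_p F (ffun_cons2 p c).
Proof.
rewrite pair_bigA /= (reindex (fun z => ffun_cons2 z.2 z.1)) //=.
exists (fun a => ([ffun j => a (lift ord0 (lift ord0 j))],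
  (a ord0, a (lift ord0 ord0)))) => [[c [x y]] _|a _] /=.
  congr (_, (_, _)); rewrite ?ffunE ?unlift_none ?liftK /= ?unlift_none //.
  by apply/ffunP => j; rewrite !ffunE !liftK /= liftK.
apply/ffunP => i; rewrite ffunE /=.
case: (unliftP ord0 i) => [j ->|-> //] /=.
by case: (unliftP ord0 j) => [k ->|-> //] /=; rewrite ffunE.
Qed.

(** Fixing the tails c and d leaves a two-coordinate problem with a shifted target, for which the
    bound is uniform. Cauchy-Schwarz over the n^(2s) pairs of tails gives the remaining power of
    n. *)
Lemma interleave_bound (D : nat) (g : gT) (f h : {ffun 'I_s.+2 -> gT} -> algC) :
    (forall a, f a \is Num.real) -> (forall b, h b \is Num.real) ->
    (forall i : Iirr [set: gT], i != 0 -> D%:R <= 'chi_i 1%g) ->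
  D%:R ^+ 2 * (\sum_a \sum_b f a * h b * (n * (interleave a b == g)%:R - 1)) ^+ 2
    <= n ^+ (2 * s.+2) * ((\sum_a f a ^+ 2) * (\sum_b h b ^+ 2)).
Proof.
move=> fr hr HD.
pose T c d := \sum_p \sum_q f (ffun_cons2 p c) * h (ffun_cons2 q d) *
  interleave2_dev (g * (interleave c d)^-1) p q.
have Tr c d : T c d \is Num.real.
  apply: rpred_sum => p _; apply: rpred_sum => q _.
  by rewrite !rpredM // rpredB ?rpredM ?rpred1 ?realn.
have -> : \sum_a \sum_b f a * h b * (n * (interleave a b == g)%:R - 1) =
    \sum_(z : {ffun 'I_s -> gT} * {ffun 'I_s -> gT}) 1 * T z.1 z.2.
  rewrite sum_ffun_cons2 -(pair_bigA _ (fun c d => 1 * T c d)) /=.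
  apply: eq_bigr => c _.
  under [RHS]eq_bigr => d _ do rewrite mul1r.
  rewrite [RHS]exchange_big; apply: eq_bigr => p _ /=.
  rewrite sum_ffun_cons2; apply: eq_bigr => d _; apply: eq_bigr => q _.
  rewrite interleave_cons2 /interleave2_dev; do 4 congr (_ _ _).
  by rewrite -(inj_eq (mulIg (interleave c d)) (p.1 * q.1 * p.2 * q.2)%g) mulgKV.
apply: le_trans (_ : D%:R ^+ 2 *
  ((\sum_(z : {ffun 'I_s -> gT} * {ffun 'I_s -> gT}) 1 ^+ 2)
   * (\sum_(z : {ffun 'I_s -> gT} * {ffun 'I_s -> gT}) T z.1 z.2 ^+ 2)) <= _).
  by rewrite ler_wpM2l ?exprn_ge0 ?ler0n // cauchy_schwarz_sum.
have -> : \sum_(z : {ffun 'I_s -> gT} * {ffun 'I_s -> gT}) 1 ^+ 2 = n ^+ (2 * s).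
  rewrite expr1n sumr_const card_prod !card_ffun !card_ord natrM natrX.
  by rewrite -exprD addnn mul2n.
have -> : (2 * s.+2 = 2 * s + 4)%N by lia.
rewrite mulrCA exprD -mulrA.
rewrite ler_wpM2l ?exprn_ge0 ?ler0n //.
rewrite !sum_ffun_cons2 mulr_sumr big_distrlr pair_bigA mulr_sumr /=.
apply: ler_sum => -[c d] _ /=.
exact: interleave2_bound.
Qed.

(** This is the bound at the indicators of [A] and [B]. Integers carry it from [algC], where
    characters live, to an arbitrary [realType]. *)
Lemma interleave_count_bound (D : nat) (A B : {set {ffun 'I_s.+2 -> gT}}) (g : gT) :
    (forall i : Iirr [set: gT], i != 0 -> D%:R <= 'chi_i 1%g) ->
  D%:Z ^+ 2 * (#|gT|%:Z * #|[set x in setX A B | interleave x.1 x.2 == g]|%:Z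
    - #|A|%:Z * #|B|%:Z) ^+ 2 <= #|gT|%:Z ^+ (2 * s.+2) * (#|A|%:Z * #|B|%:Z).
Proof.
move=> HD; rewrite -(ler_int algC) !(rmorphM, rmorphB, rmorphXn) /=.
have := @interleave_bound D g (fun a => (a \in A)%:R) (fun b => (b \in B)%:R)
  (fun _ => realn _ _) (fun _ => realn _ _) HD.
have sq (S : {set {ffun 'I_s.+2 -> gT}}) : \sum_a (a \in S)%:R ^+ 2 = #|S|%:R :> algC.
  rewrite -sum1_card natr_sum [RHS]big_mkcond /=; apply: eq_bigr => a _.
  by case: (a \in S); rewrite ?expr1n ?expr0n.
rewrite !sq -!pmulrn; suff -> : \sum_a \sum_b (a \in A)%:R * (b \in B)%:R *
    (n * (interleave a b == g)%:R - 1) =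
  n * #|[set x in setX A B | interleave x.1 x.2 == g]|%:R - #|A|%:R * #|B|%:R by [].
have card1 (T : finType) (S : {set T}) : #|S|%:R = \sum_x (x \in S)%:R :> algC.
  by rewrite -sum1_card natr_sum [LHS]big_mkcond /=; apply: eq_bigr => x _; case: ifP.
rewrite !card1 big_distrlr /= mulr_sumr !pair_bigA -sumrB /=.
apply: eq_bigr => -[a b] _; rewrite !inE /= -!mulnb !natrM; ring.
Qed.

End MixingMany.

(** * From the counting bound to densities and probabilities *)

Theorem theorem1p6 (R : realType) (alpha beta : R)
    (alpha_gt0 : 0 < alpha) (beta_gt0 : 0 < beta) :
  (forall delta : R, 0 < delta ->
    exists N : nat,
      forall (gT : finGroupType) (t : nat) (A B : {set {ffun 'I_t -> gT}})
             (g : gT),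
        nonabelian_simple gT -> (N <= #|gT|)%N -> (2 <= t)%N ->
        density R A = alpha -> density R B = beta ->
        exists eps : R,
          `|eps| <= delta /\
          prob_interleave R A B g = (1 + eps) * #|gT|%:R^-1)
  /\
  (exists N : nat,
    forall (gT : finGroupType) (t : nat) (A B : {set {ffun 'I_t -> gT}}),
      nonabelian_simple gT -> (N <= #|gT|)%N -> (2 <= t)%N ->
      density R A = alpha -> density R B = beta ->
      interleave_set A B = [set: gT]).
Proof.
have mixing (delta : R) : 0 < delta -> exists N : nat,
      forall (gT : finGroupType) (t : nat) (A B : {set {ffun 'I_t -> gT}})
             (g : gT),
        nonabelian_simple gT -> (N <= #|gT|)%N -> (2 <= t)%N ->
        density R A = alpha -> density R B = beta ->
        exists eps : R,
          `|eps| <= delta /\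
          prob_interleave R A B g = (1 + eps) * #|gT|%:R^-1.
  (* Degrees will be at least D + 1, so the squared relative error is at most 1 / ((D + 1)^2 alpha
     beta). Truncation makes D + 1, and hence its square, exceed 1 / (delta^2 alpha beta). *)
  move=> delta_gt0; pose D := Num.truncn (delta ^+ 2 * (alpha * beta))^-1.
  have [N HN] := nonabelian_simple_irr_degree D; exists N.+1.
  move=> gT [|[|s]] // A B g simpG Ncard _ dA dB.
  have := interleave_count_bound A B g (HN gT simpG Ncard).
  rewrite -(ler_int R) !(rmorphM, rmorphB, rmorphXn) /= -!pmulrn.
  rewrite /prob_interleave /uniform_prob cardsX natrM.
  set n := #|gT|%:R; set a := #|A|%:R; set b := #|B|%:R.
  set S := #|_|%:R => bound.
  have n_gt0 : 0 < n by rewrite ltr0n; apply/card_gt0P; exists g.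
  have nt_gt0 : 0 < n ^+ s.+2 by rewrite exprn_gt0.
  have aE : a = alpha * n ^+ s.+2 by rewrite -dA /density divfK // gt_eqF.
  have bE : b = beta * n ^+ s.+2 by rewrite -dB /density divfK // gt_eqF.
  have a_gt0 : 0 < a by rewrite aE mulr_gt0.
  have b_gt0 : 0 < b by rewrite bE mulr_gt0.
  have ab_gt0 : 0 < a * b by rewrite mulr_gt0.
  exists (n * S / (a * b) - 1); split; last first.
    by rewrite addrC subrK; field; rewrite !gt_eqF.
  rewrite -ler_sqr ?nnegrE ?(ltW delta_gt0) ?normr_ge0 // real_normK ?num_real //.
  have -> : n * S / (a * b) - 1 = (n * S - a * b) / (a * b).
    by rewrite mulrBl divff ?gt_eqF.
  rewrite expr_div_n ler_pdivrMr ?exprn_gt0 //.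
  have DD : (delta ^+ 2 * (alpha * beta))^-1 <= D.+1%:R ^+ 2.
    apply: (@le_trans _ _ D.+1%:R); first by rewrite ltW // truncnS_gt.
    by rewrite -natrX ler_nat expnS expn1 leq_pmulr.
  have dab_gt0 : 0 < delta ^+ 2 * (alpha * beta) by rewrite !mulr_gt0 ?exprn_gt0.
  have D2_gt0 : 0 < D.+1%:R ^+ 2 :> R by rewrite exprn_gt0 ?ltr0n.
  rewrite -(ler_pM2l D2_gt0); apply: le_trans bound _.
  have -> : n ^+ (2 * s.+2) * (a * b) = 1 * (n ^+ s.+2) ^+ 2 * (a * b).
    by rewrite mul1r -exprM mulnC.
  (* One factor a b is kept and the other becomes alpha beta n^(2t), so that the powers of n
     cancel. *)
  have -> : D.+1%:R ^+ 2 * (delta ^+ 2 * (a * b) ^+ 2) =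
    (delta ^+ 2 * (alpha * beta) * D.+1%:R ^+ 2) * (n ^+ s.+2) ^+ 2 * (a * b).
    by rewrite [in LHS]aE [in LHS]bE aE bE; ring.
  rewrite ler_pM2r // ler_pM2r ?exprn_gt0 //.
  by rewrite -[leLHS](mulfV (lt0r_neq0 dab_gt0)) ler_pM2l.
(* An error of at most 1/2 keeps 1 + eps positive, whereas a missed g would have probability 0. *)
split=> //; have [|N HN] := mixing 2^-1; first by rewrite invr_gt0.
exists N => gT t A B simpG Ncard t2 dA dB; apply/setP => g; rewrite inE.
have [eps [eps_le prob]] := HN gT t A B g simpG Ncard t2 dA dB.
have n_gt0 : 0 < #|gT|%:R :> R by rewrite ltr0n; apply/card_gt0P; exists g.
have : prob_interleave R A B g != 0.
  rewrite prob mulf_neq0 ?invr_eq0 ?(gt_eqF n_gt0) // gt_eqF //.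
  by move: eps_le; rewrite ler_norml => /andP[]; lra.
apply: contraNT => gAB; rewrite /prob_interleave /uniform_prob.
suff -> : [set x in setX A B | interleave x.1 x.2 == g] = set0 by rewrite cards0 mul0r.
apply/setP => -[a b]; rewrite !inE /=; apply: contraNF gAB.
move=> /andP[/andP[aA bB] /eqP <-].
by apply/imset2P; exists a b.
Qed.
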